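(* Let $H$ be a finite-dimensional Hopf algebra over a field $k$ with a nonzero left integral $t$, and let $A$ be a unital $k$-algebra with a symmetric (left) partial action of $H$ such that $h\cdot 1_A$ is central in $A$ for every $h\in H$. Give $A$ the induced partial $H^*$-comodule structure $\overline{\rho}(a)=\sum a^{[0]}\otimes a^{[1]}\in A\otimes H^*$. Then the following are equivalent: (i) The canonical map $\beta:A\otimes_{A^{\underline{H}}}A\to\underline{A\otimes H^*}$, $\beta(\sum x_i\otimes y_i)=\sum x_iy_i^{[0]}\otimes y_i^{[1]}$, is surjective. (ii) $A$ is a finitely generated projective right $A^{\underline{H}}$-module and $A^{\underline{H}}\subset A$ is a partial $H^*$-Hopf Galois extension. (iii) $A$ is a finitely generated projective right $A^{\underline{H}}$-module and the map $[\cdot,\cdot]:A\otimes_{A^{\underline{H}}}A\to\underline{A\# H}$, $[a,b]=(\underline{a\# 1_H})(\underline{1_A\# t})(\underline{b\# 1_H})$, is surjective.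
   Context: Sweedler notation is used; $\epsilon$ is the counit. A left integral is $t\in H$ with $ht=\epsilon(h)t$ for all $h\in H$. A partial action of a Hopf algebra $H$ on a unital algebra $A$ is a linear map $H\otimes A\to A$, $h\otimes a\mapsto h\cdot a$, with (i) $h\cdot(ab)=\sum(h_{(1)}\cdot a)(h_{(2)}\cdot b)$; (ii) $1_H\cdot a=a$; (iii) $h\cdot(g\cdot a)=\sum(h_{(1)}\cdot 1_A)((h_{(2)}g)\cdot a)$. It is symmetric if also (iv) $h\cdot(g\cdot a)=\sum((h_{(1)}g)\cdot a)(h_{(2)}\cdot 1_A)$. Partial invariants: $A^{\underline{H}}=\{a\in A: h\cdot a=a(h\cdot 1_A)\ \forall h\in H\}$, a subalgebra of $A$. Partial smash product: $A\otimes H$ is an associative algebra under $(a\otimes h)(b\otimes g)=\sum a(h_{(1)}\cdot b)\otimes h_{(2)}g$, and $\underline{A\# H}=(A\otimes H)(1_A\otimes 1_H)$, i.e. the span of the elements $\underline{a\# h}=\sum a(h_{(1)}\cdot 1_A)\otimes h_{(2)}$. The map $[\cdot,\cdot]$ is well defined on $A\otimes_{A^{\underline{H}}}A$. Induced partial $H^*$-coaction: for a basis $\{h_i\}$ of $H$ with dual basis $\{h_i^*\}$, $\overline{\rho}:A\to A\otimes H^*$, $\overline{\rho}(a)=\sum_i (h_i\cdot a)\otimes h_i^*$, written $\sum a^{[0]}\otimes a^{[1]}$; equivalently $h\cdot a=\sum a^{[0]}a^{[1]}(h)$. $A\otimes H^*$ is an $A$–$A$ bimodule by left multiplication and $(a\otimes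 f)b=\sum ab^{[0]}\otimes fb^{[1]}$ (convolution product in $H^*$), and $\underline{A\otimes H^*}=(A\otimes H^* )1_A$ is the sub-bimodule spanned by the elements $\sum a1_A^{[0]}\otimes f1_A^{[1]}$, $a\in A$, $f\in H^*$. The coinvariants $A^{\underline{coH^*}}=\{a\in A:\overline{\rho}(a)=a\overline{\rho}(1_A)\}$ (where $a(b\otimes f)=ab\otimes f$) coincide with $A^{\underline{H}}$. The extension $A^{\underline{H}}\subset A$ is called partial $H^*$-Hopf Galois if $\beta$ is a bijective $A$–$A$ bimodule morphism. *)

(* Defs.v *)
From HB Require Import structures.
From mathcomp Require Import all_boot all_order all_algebra all_field.
From mathcomp Require Import generic_quotient.
From mathcomp Require Import boolp classical_sets functions.

Set Implicit Arguments.
Unset Strict Implicit.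
Unset Printing Implicit Defensive.

Import GRing.Theory.
Local Open Scope quotient_scope.
Local Open Scope ring_scope.

Section Tensor.
Variables (S : Type) (M N : zmodType) (ra : S -> M -> M) (la : S -> N -> N).

(* The tensor product of a right [S]-module [M] (action [ra]) and a left
   [S]-module [N] (action [la]): a formal sum of pure tensors is a sequence of
   pairs, and [tens_eq] is the congruence generated by the tensor relations.
   No formal opposites are needed, as -(m ⊗ n) is (-m) ⊗ n. *)
Inductive tens_eq : seq (M * N) -> seq (M * N) -> Prop :=
| tens_eq_refl s : tens_eq s s
| tens_eq_sym s t : tens_eq s t -> tens_eq t s
| tens_eq_trans t s u : tens_eq s t -> tens_eq t u -> tens_eq s u
| tens_eq_cat s s' t t' :
    tens_eq s t -> tens_eq s' t' -> tens_eq (s ++ s') (t ++ t')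
| tens_eq_comm s t : tens_eq (s ++ t) (t ++ s)
| tens_eq_0l n : tens_eq [:: (0, n)] [::]
| tens_eq_Dl m m' n : tens_eq [:: (m + m', n)] [:: (m, n); (m', n)]
| tens_eq_Dr m n n' : tens_eq [:: (m, n + n')] [:: (m, n); (m, n')]
| tens_eq_bal s m n : tens_eq [:: (ra s m, n)] [:: (m, la s n)].

Definition tens_rel : rel (seq (M * N)) := fun s t => `[< tens_eq s t >].

Lemma tens_rel_refl : reflexive tens_rel.
Proof. by move=> s; apply/asboolP; exact: tens_eq_refl. Qed.
Lemma tens_rel_sym : symmetric tens_rel.
Proof. by move=> s t; apply/asboolP/asboolP; exact: tens_eq_sym. Qed.
Lemma tens_rel_trans : transitive tens_rel.
Proof.
by move=> t s u /asboolP st /asboolP tu; apply/asboolP; exact: tens_eq_trans tu.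
Qed.

Canonical tens_equiv :=
  EquivRel tens_rel tens_rel_refl tens_rel_sym tens_rel_trans.

Definition tens : Type := {eq_quot tens_equiv}.
HB.instance Definition _ := Choice.on tens.
HB.instance Definition _ := EqQuotient.on tens.

Definition tclass (s : seq (M * N)) : tens := \pi_tens s.
Definition trep (x : tens) : seq (M * N) := repr x.
Definition tpure (m : M) (n : N) : tens := tclass [:: (m, n)].

Lemma trepK x : tclass (trep x) = x. Proof. exact: reprK. Qed.

Lemma tclassP s t : tclass s = tclass t <-> tens_eq s t.
Proof.
split; first by move/eqmodP/asboolP.
by move=> st; apply/eqmodP/asboolP.
Qed.

Lemma trep_class s : tens_eq (trep (tclass s)) s.
Proof. by apply/tclassP; rewrite trepK. Qed.

Definition tadd (x y : tens) : tens := tclass (trep x ++ trep y).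
Definition tneg (s : seq (M * N)) := [seq (- p.1, p.2) | p <- s].
Definition topp (x : tens) : tens := tclass (tneg (trep x)).

Lemma tadd_class s t : tadd (tclass s) (tclass t) = tclass (s ++ t).
Proof. by apply/tclassP/tens_eq_cat; exact: trep_class. Qed.

Lemma taddA : associative tadd.
Proof.
by move=> x y z; rewrite -[x]trepK -[y]trepK -[z]trepK !tadd_class catA.
Qed.
Lemma taddC : commutative tadd.
Proof.
by move=> x y; rewrite -[x]trepK -[y]trepK !tadd_class; apply/tclassP/tens_eq_comm.
Qed.
Lemma tadd0 : left_id (tclass [::]) tadd.
Proof. by move=> x; rewrite -[x]trepK !tadd_class. Qed.
Lemma tens_eq_neg s : tens_eq (tneg s ++ s) [::].
Proof.
elim: s => [|[m n] s IHs]; first exact: tens_eq_refl.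
apply: (@tens_eq_trans ([:: (- m, n); (m, n)] ++ (tneg s ++ s))).
  rewrite /= -cat1s; apply: (tens_eq_cat (tens_eq_refl [:: (-m, n)])).
  rewrite -cat1s -(cat1s _ (tneg _ ++ _)) !catA.
  by apply: tens_eq_cat; [exact: tens_eq_comm|exact: tens_eq_refl].
rewrite -[[::]]/([::] ++ [::]); apply: tens_eq_cat => //.
by apply: tens_eq_trans (tens_eq_sym (tens_eq_Dl _ _ _)) _; rewrite addNr; exact: tens_eq_0l.
Qed.
Lemma taddN : left_inverse (tclass [::]) topp tadd.
Proof.
move=> x; rewrite -{2}[x]trepK /topp tadd_class.
by apply/tclassP/tens_eq_neg.
Qed.

HB.instance Definition _ := GRing.isZmodule.Build tens taddA taddC tadd0 taddN.

Lemma tclass_sum s : tclass s = \sum_(p <- s) tpure p.1 p.2.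
Proof.
elim: s => [|[m n] s IHs]; first by rewrite big_nil.
by rewrite big_cons -IHs -[RHS]/(tadd _ _) /tpure tadd_class.
Qed.

Lemma tens_repE x : x = \sum_(p <- trep x) tpure p.1 p.2.
Proof. by rewrite -tclass_sum trepK. Qed.

Lemma tens_ind (P : tens -> Prop) :
  P 0 -> (forall m n x, P x -> P (tpure m n + x)) -> forall x, P x.
Proof.
move=> P0 PD x; rewrite [x]tens_repE.
by elim: (trep x) => [|p s IHs]; rewrite ?big_nil ?big_cons //; exact: PD.
Qed.

Lemma tpureDl m m' n : tpure (m + m') n = tpure m n + tpure m' n.
Proof. by rewrite -[RHS]/(tadd _ _) tadd_class; apply/tclassP/tens_eq_Dl. Qed.
Lemma tpureDr m n n' : tpure m (n + n') = tpure m n + tpure m n'.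
Proof. by rewrite -[RHS]/(tadd _ _) tadd_class; apply/tclassP/tens_eq_Dr. Qed.
Lemma tpure_bal s m n : tpure (ra s m) n = tpure m (la s n).
Proof. by apply/tclassP/tens_eq_bal. Qed.

Definition balanced (V : zmodType) (f : M -> N -> V) :=
  [/\ forall m m' n, f (m + m') n = f m n + f m' n,
      forall m n n', f m (n + n') = f m n + f m n' &
      forall s m n, f (ra s m) n = f m (la s n)].

(* The additive map induced by a balanced [f] (see [tliftE] and [tliftD]).
   It is total, and independent of the chosen representative only when [f] is
   balanced. *)
Definition tlift (V : zmodType) (f : M -> N -> V) (x : tens) : V :=
  \sum_(p <- trep x) f p.1 p.2.

Section Lift.
Variables (V : zmodType) (f : M -> N -> V) (fB : balanced f).

Lemma tens_eq_sum s t :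
  tens_eq s t -> \sum_(p <- s) f p.1 p.2 = \sum_(p <- t) f p.1 p.2.
Proof.
have [fDl fDr fS] := fB.
elim=> {s t} [//|s t _ -> //|t s u _ -> _ -> //|s s' t t' _ e _ e'|s t|n|m m' n
  |m n n'|s m n]; rewrite ?big_cat ?big_cons ?big_nil /= ?addr0 ?e ?e' ?fDl ?fDr //.
- by rewrite addrC.
- by apply: (addrI (f 0 n)); rewrite -fDl !addr0.
Qed.

Lemma tlift_class s : tlift f (tclass s) = \sum_(p <- s) f p.1 p.2.
Proof. exact/tens_eq_sum/trep_class. Qed.
Lemma tliftE m n : tlift f (tpure m n) = f m n.
Proof. by rewrite tlift_class big_seq1. Qed.
Lemma tliftD : {morph tlift f : x y / x + y}.
Proof.
move=> x y; rewrite -[x]trepK -[y]trepK -[_ + _]/(tadd _ _) tadd_class.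
by rewrite !tlift_class big_cat.
Qed.
Lemma tlift0 : tlift f 0 = 0.
Proof. by rewrite tlift_class big_nil. Qed.
Lemma tlift_sum (I : Type) (r : seq I) (F : I -> tens) :
  tlift f (\sum_(i <- r) F i) = \sum_(i <- r) tlift f (F i).
Proof. exact: (big_morph _ tliftD tlift0). Qed.
End Lift.

End Tensor.

Section ScalarTensor.
Variables (k : fieldType) (M N : lmodType k).

Definition ktens : Type :=
  tens (fun (c : k) (m : M) => c *: m) (fun (c : k) (n : N) => c *: n).
HB.instance Definition _ := GRing.Zmodule.on ktens.
Definition kpure (m : M) (n : N) : ktens := tpure _ _ m n.

Definition kscale (c : k) (x : ktens) : ktens :=
  tlift (fun m n => kpure (c *: m) n) x.

Lemma kscale_balanced c :
  balanced (fun (c : k) (m : M) => c *: m) (fun (c : k) (n : N) => c *: n)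
    (fun m n => kpure (c *: m) n).
Proof.
split=> [m m' n|m n n'|s m n].
- by rewrite scalerDr; exact: tpureDl.
- exact: tpureDr.
- by rewrite scalerA mulrC -scalerA; exact: tpure_bal.
Qed.

Lemma kscaleE c m n : kscale c (kpure m n) = kpure (c *: m) n.
Proof. exact: (tliftE (kscale_balanced c)). Qed.
Lemma kscaleDr c : {morph kscale c : x y / x + y}.
Proof. exact: (tliftD (kscale_balanced c)). Qed.
Lemma kscale0r c : kscale c 0 = 0.
Proof. exact: (tlift0 (kscale_balanced c)). Qed.
Lemma kscaleA a b x : kscale a (kscale b x) = kscale (a * b) x.
Proof.
elim/tens_ind: x => [|m n x IHx]; first by rewrite !kscale0r.
by rewrite !kscaleDr IHx !kscaleE scalerA.
Qed.
Lemma kscale1 : left_id 1 kscale.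
Proof.
elim/tens_ind=> [|m n x IHx]; first by rewrite !kscale0r.
by rewrite !kscaleDr IHx !kscaleE scale1r.
Qed.
Lemma kscaleDl x a b : kscale (a + b) x = kscale a x + kscale b x.
Proof.
elim/tens_ind: x => [|m n x IHx]; first by rewrite !kscale0r addr0.
rewrite !kscaleDr IHx !kscaleE scalerDl addrACA; congr (_ + _).
exact: tpureDl.
Qed.
HB.instance Definition _ := GRing.Zmodule_isLmodule.Build k ktens
  kscaleA kscale1 kscaleDr kscaleDl.

End ScalarTensor.

Notation "m ⊗ n" := (kpure m n) (at level 40, left associativity) : ring_scope.

(* Sweedler-style sums: with [x = comul h], the variables [m], [n] stand for
   h_(1), h_(2). *)
Notation "\tsum_ ( m , n <- x ) F" := (tlift (fun m n => F) x)
  (at level 41, F at level 41, x at level 50, m binder, n binder,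
   format "'[' \tsum_ ( m ,  n  <-  x ) '/  '  F ']'") : ring_scope.

HB.mixin Record isHopf (k : fieldType) H of Falgebra k H := {
  comul : {linear H -> ktens H H};
  counit : {linear H -> k^o};
  antipode : {linear H -> H};
  comulA : forall h : H,
    \tsum_(h1, h2 <- comul h) \tsum_(h11, h12 <- comul h1) (h11 ⊗ (h12 ⊗ h2))
    = \tsum_(h1, h2 <- comul h) (h1 ⊗ comul h2);
  counitl : forall h : H, \tsum_(h1, h2 <- comul h) (counit h1 *: h2) = h;
  counitr : forall h : H, \tsum_(h1, h2 <- comul h) (counit h2 *: h1) = h;
  comul1 : comul 1 = 1 ⊗ 1;
  comulM : forall h g : H, comul (h * g) =
    \tsum_(h1, h2 <- comul h) \tsum_(g1, g2 <- comul g)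
      ((h1 * g1) ⊗ (h2 * g2));
  counit1 : counit 1 = 1;
  counitM : forall h g : H, counit (h * g) = counit h * counit g;
  antipodel : forall h : H,
    \tsum_(h1, h2 <- comul h) (antipode h1 * h2) = (counit h : k)%:A;
  antipoder : forall h : H,
    \tsum_(h1, h2 <- comul h) (h1 * antipode h2) = (counit h : k)%:A;
}.

(* Finite dimensionality is part of [falgType]. *)
#[short(type="hopfAlgType")]
HB.structure Definition HopfAlgebra (k : fieldType) :=
  {H of Falgebra k H & isHopf k H}.

Definition left_integral (k : fieldType) (H : hopfAlgType k) (t : H) :=
  forall h : H, h * t = (counit h : k) *: t.

Section TensorLemmas.
Variables (k : fieldType) (M N : lmodType k).

Definition kbalanced (V : zmodType) (f : M -> N -> V) :=
  balanced (fun (c : k) (m : M) => c *: m) (fun (c : k) (n : N) => c *: n) f.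

Lemma kpureDl (m m' : M) (n : N) : (m + m') ⊗ n = m ⊗ n + m' ⊗ n.
Proof. exact: tpureDl. Qed.
Lemma kpureDr (m : M) (n n' : N) : m ⊗ (n + n') = m ⊗ n + m ⊗ n'.
Proof. exact: tpureDr. Qed.
Lemma kpureZ (c : k) (m : M) (n : N) : (c *: m) ⊗ n = m ⊗ (c *: n).
Proof. exact: tpure_bal. Qed.
Lemma kpureB : kbalanced (fun (m : M) (n : N) => m ⊗ n).
Proof. by split; [exact: kpureDl|exact: kpureDr|exact: kpureZ]. Qed.
Lemma kpure_suml (I : Type) (r : seq I) (F : I -> M) (n : N) :
  (\sum_(i <- r) F i) ⊗ n = \sum_(i <- r) F i ⊗ n.
Proof.
have p0 : (0 : M) ⊗ n = 0 by apply: (addrI (0 ⊗ n)); rewrite -kpureDl !addr0.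
exact: (big_morph (fun m => m ⊗ n) (fun m m' => kpureDl m m' n) p0).
Qed.
Lemma kpure_sumr (I : Type) (r : seq I) (m : M) (F : I -> N) :
  m ⊗ (\sum_(i <- r) F i) = \sum_(i <- r) m ⊗ F i.
Proof.
have p0 : m ⊗ (0 : N) = 0 by apply: (addrI (m ⊗ 0)); rewrite -kpureDr !addr0.
exact: (big_morph (fun n => m ⊗ n) (kpureDr m) p0).
Qed.

Lemma ktens_ind (P : ktens M N -> Prop) :
  P 0 -> (forall m n x, P x -> P (m ⊗ n + x)) -> forall x, P x.
Proof. exact: tens_ind. Qed.

Variables (V : zmodType) (f : M -> N -> V) (fB : kbalanced f).
Lemma ktliftE m n : \tsum_(m, n <- m ⊗ n) f m n = f m n.
Proof. exact: tliftE. Qed.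
Lemma ktliftD (x y : ktens M N) : tlift f (x + y) = tlift f x + tlift f y.
Proof. exact: tliftD. Qed.
Lemma ktlift0 : tlift f (0 : ktens M N) = 0.
Proof. exact: tlift0. Qed.
Lemma ktlift_sum (I : Type) (r : seq I) (F : I -> ktens M N) :
  tlift f (\sum_(i <- r) F i) = \sum_(i <- r) tlift f (F i).
Proof. exact: tlift_sum. Qed.
Lemma ktlift_tsum (M' N' : lmodType k) (x : ktens M' N')
    (F : M' -> N' -> ktens M N) :
  tlift f (\tsum_(m', n' <- x) F m' n') = \tsum_(m', n' <- x) tlift f (F m' n').
Proof. exact: tlift_sum. Qed.

End TensorLemmas.

Section Dual.
Variables (k : fieldType) (H : hopfAlgType k).
Implicit Types f g : 'Hom(H, k^o).

(* The convolution product of the dual algebra. *)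
Definition conv f g : 'Hom(H, k^o) :=
  linfun (fun h => \tsum_(h1, h2 <- comul h) (f h1 * g h2 : k^o)).

Definition hbasis (i : 'I_(\dim {:H})) : H := (vbasis {:H})`_i.
Definition hdual (i : 'I_(\dim {:H})) : 'Hom(H, k^o) :=
  linfun (fun h => coord (vbasis {:H}) i h : k^o).

Lemma conv_balanced f g :
  kbalanced (fun h1 h2 : H => f h1 * g h2 : k^o).
Proof.
split=> [h h' g'|h g' g''|c h g'].
- by rewrite linearD mulrDl.
- by rewrite linearD mulrDr.
- by rewrite !linearZ /= -scalerAl -scalerAr.
Qed.

Lemma convE f g h : conv f g h = \tsum_(h1, h2 <- comul h) (f h1 * g h2 : k^o).
Proof.
pose F h := \tsum_(h1, h2 <- comul h) (f h1 * g h2 : k^o).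
have Flin : linear F.
  move=> c x y; rewrite /F linearP /=.
  rewrite (ktliftD (conv_balanced f g)); congr (_ + _).
  elim/ktens_ind: (comul x) => [|h1 h2 z IHz].
    by rewrite scaler0 (ktlift0 (conv_balanced f g)) scaler0.
  rewrite scalerDr !(ktliftD (conv_balanced f g)) IHz scalerDr; congr (_ + _).
  have -> : c *: (h1 ⊗ h2) = (c *: h1) ⊗ h2 by exact: kscaleE.
  rewrite !(ktliftE (conv_balanced f g)).
  by rewrite linearZ /= -scalerAl.
pose FL := GRing.isLinear.Build k H k^o _ F Flin.
pose FF : {linear H -> k^o} := HB.pack F FL.
exact: (lfunE FF).
Qed.

Lemma convDl f f' g : conv (f + f') g = conv f g + conv f' g.
Proof.
apply/lfunP=> h; rewrite add_lfunE !convE /tlift -big_split.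
by apply: eq_bigr => p _; rewrite add_lfunE mulrDl.
Qed.
Lemma convDr f g g' : conv f (g + g') = conv f g + conv f g'.
Proof.
apply/lfunP=> h; rewrite add_lfunE !convE /tlift -big_split.
by apply: eq_bigr => p _; rewrite add_lfunE mulrDr.
Qed.
Lemma convZl c f g : conv (c *: f) g = c *: conv f g.
Proof.
apply/lfunP=> h; rewrite scale_lfunE !convE /tlift scaler_sumr.
by apply: eq_bigr => p _; rewrite scale_lfunE scalerAl.
Qed.
Lemma convZr c f g : conv f (c *: g) = c *: conv f g.
Proof.
apply/lfunP=> h; rewrite scale_lfunE !convE /tlift scaler_sumr.
by apply: eq_bigr => p _; rewrite scale_lfunE scalerAr.
Qed.

Lemma hbasisE (h : H) : h = \sum_i (hdual i h : k) *: hbasis i.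
Proof.
rewrite {1}(coord_vbasis (memvf h)); apply: eq_bigr => i _.
by rewrite lfunE.
Qed.

Lemma hdualE f : f = \sum_i (f (hbasis i) : k) *: hdual i.
Proof.
apply/lfunP=> h; rewrite {1}(hbasisE h) linear_sum sum_lfunE.
apply: eq_bigr => i _; rewrite linearZ /= scale_lfunE.
exact: mulrC.
Qed.

Lemma comulA_lift (V : zmodType) (F : H -> H -> H -> V) (h : H) :
  (forall x, kbalanced (F x)) ->
  (forall x x' y z, F (x + x') y z = F x y z + F x' y z) ->
  (forall c x y z, F (c *: x) y z = F x (c *: y) z) ->
  \tsum_(h1, h2 <- comul h) \tsum_(h11, h12 <- comul h1) F h11 h12 h2 =
  \tsum_(h1, h2 <- comul h) \tsum_(h21, h22 <- comul h2) F h1 h21 h22.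
Proof.
move=> FB FD FZ.
pose L (x : H) (u : ktens H H) := tlift (F x) u.
have LB : kbalanced L.
  split=> [x x' u|x u u'|c x u].
  - by rewrite /L /tlift -big_split; apply: eq_bigr => p _; rewrite FD.
  - exact: (ktliftD (FB x)).
  - rewrite /L; elim/ktens_ind: u => [|y z u IHu].
      by rewrite scaler0 !ktlift0.
    have -> : c *: (y ⊗ z + u) = (c *: y) ⊗ z + c *: u.
      by rewrite scalerDr; congr (_ + _); exact: kscaleE.
    by rewrite !ktliftD // IHu !ktliftE // FZ.
have := congr1 (tlift L) (comulA h).
rewrite !(ktlift_tsum LB) => e.
transitivity (\sum_(p <- trep (comul h)) L p.1 (comul p.2)); last by [].
transitivity (\sum_(p <- trep (comul h))
    tlift L (\tsum_(h11, h12 <- comul p.1) (h11 ⊗ (h12 ⊗ p.2)))).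
  apply: eq_bigr => p _; rewrite (ktlift_tsum LB).
  by apply: eq_bigr => q _; rewrite (ktliftE LB) /L ktliftE.
rewrite -[LHS]/(\tsum_(h1, h2 <- comul h)
  tlift L (\tsum_(h11, h12 <- comul h1) (h11 ⊗ (h12 ⊗ h2)))) e.
by apply: eq_bigr => p _; rewrite (ktliftE LB).
Qed.

End Dual.

Record partial_action (k : fieldType) (H : hopfAlgType k) (A : algType k) :=
  PartialAction {
  pact :> H -> A -> A;
  pact_linearl : forall a, linear (fun h => pact h a);
  pact_linearr : forall h, linear (pact h);
  pactM : forall h a b,
    pact h (a * b) = \tsum_(h1, h2 <- comul h) (pact h1 a * pact h2 b);
  pact1 : forall a, pact 1 a = a;
  pactA : forall h g a, pact h (pact g a) =
    \tsum_(h1, h2 <- comul h) (pact h1 1 * pact (h2 * g) a)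
}.

Definition symmetric_paction (k : fieldType) (H : hopfAlgType k)
    (A : algType k) (act : partial_action H A) :=
  forall h g a, act h (act g a) =
    \tsum_(h1, h2 <- comul h) (act (h1 * g) a * act h2 1).

(* [A] as a right module over the partial invariants, i.e. as a left module
   over the opposite ring. *)
Definition A_right (k : fieldType) (H : hopfAlgType k) (A : algType k)
  (act : partial_action H A) : Type := A.

Section PartialAction.
Variables (k : fieldType) (H : hopfAlgType k) (A : algType k).
Variable act : partial_action H A.
Local Notation "h · a" := (act h a) (at level 39).

Lemma actDl h g a : (h + g) · a = h · a + g · a.
Proof. by have := pact_linearl act a 1 h g; rewrite !scale1r. Qed.
Lemma actDr h a b : h · (a + b) = h · a + h · b.
Proof. by have := pact_linearr act h 1 a b; rewrite !scale1r. Qed.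
Lemma act0l a : (0 : H) · a = 0.
Proof. by apply: (addrI (0 · a)); rewrite -actDl !addr0. Qed.
Lemma act0r h : h · 0 = 0.
Proof. by apply: (addrI (h · 0)); rewrite -actDr !addr0. Qed.
Lemma actZl c h a : (c *: h) · a = c *: (h · a).
Proof. by have := pact_linearl act a c h 0; rewrite !addr0 act0l addr0. Qed.
Lemma actZr c h a : h · (c *: a) = c *: (h · a).
Proof. by have := pact_linearr act h c a 0; rewrite !addr0 act0r addr0. Qed.
Lemma actN h a : h · (- a) = - (h · a).
Proof. by rewrite -scaleN1r actZr scaleN1r. Qed.

(* The subalgebra of partial invariants, as a predicate and as a ring. *)
Definition pinv : {pred A} :=
  fun a => `[< forall h, h · a = a * (h · 1) >].

Lemma pinvP a : reflect (forall h, h · a = a * (h · 1)) (a \in pinv).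
Proof. exact: asboolP. Qed.

Lemma act_pinvM h s a : s \in pinv -> h · (s * a) = s * (h · a).
Proof.
move=> /pinvP sP; rewrite -{2}[a]mul1r !pactM /tlift mulr_sumr.
by apply: eq_bigr => p _; rewrite sP mulrA.
Qed.

Lemma pinv_subring : subring_closed pinv.
Proof.
split=> [|a b /pinvP aP /pinvP bP|a b aP bP]; apply/pinvP => h.
- by rewrite mul1r.
- by rewrite actDr actN aP bP mulrBl.
- by rewrite act_pinvM //; move/pinvP: bP => ->; rewrite mulrA.
Qed.
HB.instance Definition _ := GRing.isSubringClosed.Build A pinv pinv_subring.

Record pinv_type := PInv { pinv_val : A; _ : pinv_val \in pinv }.
HB.instance Definition _ := [isSub for pinv_val].
HB.instance Definition _ := [Choice of pinv_type by <:].
HB.instance Definition _ := [SubChoice_isSubNzRing of pinv_type by <:].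

HB.instance Definition _ := GRing.Zmodule.on (A_right act).
Definition rscale (s : pinv_type^c) (a : A_right act) : A_right act :=
  (a : A) * \val (s : pinv_type).
Lemma rscaleA s s' a : rscale s (rscale s' a) = rscale (s * s') a.
Proof. exact: esym (mulrA (a : A) _ _). Qed.
Lemma rscale1 : left_id 1 rscale.
Proof. by move=> a; exact: (mulr1 (a : A)). Qed.
Lemma rscaleDr : right_distributive rscale +%R.
Proof. by move=> s a b; exact: (mulrDl (a : A) b _). Qed.
Lemma rscaleDl a s s' : rscale (s + s') a = rscale s a + rscale s' a.
Proof. exact: (mulrDr (a : A)). Qed.
HB.instance Definition _ := GRing.Zmodule_isLmodule.Build pinv_type^c (A_right act)
  rscaleA rscale1 rscaleDr rscaleDl.


(* A ⊗_{A^H} A *)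
Definition AtensA : Type :=
  tens (fun (s : pinv_type) (a : A) => a * \val s)
       (fun (s : pinv_type) (b : A) => \val s * b).
HB.instance Definition _ := GRing.Zmodule.on AtensA.
Definition apure (a b : A) : AtensA := tpure _ _ a b.
Definition AtensA_lmul (c : A) (x : AtensA) : AtensA :=
  \tsum_(a, b <- x) apure (c * a) b.
Definition AtensA_rmul (x : AtensA) (c : A) : AtensA :=
  \tsum_(a, b <- x) apure a (b * c).

(* The left and right operations of [A] on A ⊗ H^* (the right one is not
   unital), and the induced coaction; [rho_basis] shows that the latter does not
   depend on the chosen basis. *)
Local Notation AD := (ktens A 'Hom(H, k^o)).

Definition rho (a : A) : AD := \sum_i (hbasis i · a) ⊗ hdual i.

Definition AD_lmul (a : A) (x : AD) : AD := \tsum_(b, f <- x) ((a * b) ⊗ f).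
Definition AD_rmul (x : AD) (b : A) : AD :=
  \tsum_(a, f <- x) \tsum_(b0, b1 <- rho b) ((a * b0) ⊗ (conv f b1)).
(* The elements x 1_A with x in A ⊗ H^*, the codomain of the canonical map, see
   [beta_AD1]. *)
Definition AD1 : set AD := [set AD_rmul x 1 | x in setT].

(* beta (a ⊗ b) = a b^[0] ⊗ b^[1], see [betaE]. *)
Definition beta (x : AtensA) : AD := \tsum_(a, b <- x) AD_lmul a (rho b).

Definition partial_Hopf_Galois : Prop :=
  [/\ {morph beta : x y / x + y},
      forall c x, beta (AtensA_lmul c x) = AD_lmul c (beta x),
      forall x c, beta (AtensA_rmul x c) = AD_rmul (beta x) c &
      set_bij setT AD1 beta].

Local Notation AH := (ktens A H).

Definition AH_mul (x y : AH) : AH :=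
  \tsum_(a, h <- x) \tsum_(b, g <- y) \tsum_(h1, h2 <- comul h)
    ((a * (h1 · b)) ⊗ (h2 * g)).
(* The partial smash product (A ⊗ H)(1_A ⊗ 1_H), see [smashE]. *)
Definition smash_set : set AH := [set AH_mul x (1 ⊗ 1) | x in setT].
Definition smash (a : A) (h : H) : AH :=
  \tsum_(h1, h2 <- comul h) ((a * (h1 · 1)) ⊗ h2).

(* [a, b] = (a # 1)(1 # t)(b # 1), see [bracketE] and [bracket_smash]. *)
Definition bracket (t : H) (x : AtensA) : AH :=
  \tsum_(a, b <- x) AH_mul (AH_mul (smash a 1) (smash 1 t)) (smash b 1).

Lemma rhoE h a :
  h · a = tlift (fun (a0 : A) (a1 : 'Hom(H, k^o)) => (a1 h : k) *: a0) (rho a).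
Proof.
have fB : kbalanced (fun (a0 : A) (a1 : 'Hom(H, k^o)) => (a1 h : k) *: a0).
  split=> [m m' n|m n n'|c m n]; rewrite ?scalerDr ?add_lfunE ?scalerDl //.
  by rewrite scale_lfunE scalerA mulrC.
rewrite (ktlift_sum fB) {1}(hbasisE h).
rewrite (big_morph (fun h => h · a) (fun h g => actDl h g a) (act0l a)).
by apply: eq_bigr => i _; rewrite actZl (ktliftE fB).
Qed.

Lemma rho_basis (X : (\dim {:H}).-tuple H) a : basis_of {:H} X ->
  rho a = \sum_(i < \dim {:H}) (X`_i · a) ⊗ (linfun (fun h => coord X i h : k^o)).
Proof.
move=> bX; pose D i : 'Hom(H, k^o) := linfun (fun h => coord X i h : k^o).
transitivity (\sum_i \sum_(j < \dim {:H}) (X`_j · a) ⊗ ((D j (hbasis i) : k) *: hdual i)).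
  apply: eq_bigr => i _.
  rewrite {1}(coord_basis bX (memvf (hbasis i))).
  rewrite (big_morph (fun h => h · a) (fun h g => actDl h g a) (act0l a)).
  rewrite kpure_suml; apply: eq_bigr => j _.
  by rewrite actZl kpureZ lfunE.
rewrite exchange_big; apply: eq_bigr => j _ /=.
by rewrite -kpure_sumr -hdualE.
Qed.

Lemma AD_lmulB a : kbalanced (fun (b : A) (f : 'Hom(H, k^o)) => (a * b) ⊗ f).
Proof.
split=> [m m' n|m n n'|c m n].
- by rewrite mulrDr kpureDl.
- exact: kpureDr.
- by rewrite -scalerAr kpureZ.
Qed.

Lemma rhoD a b : rho (a + b) = rho a + rho b.
Proof.
by rewrite /rho -big_split; apply: eq_bigr => i _; rewrite actDr kpureDl.
Qed.

Lemma AD_lmul_rho a b : AD_lmul a (rho b) = \sum_i (a * (hbasis i · b)) ⊗ hdual i.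
Proof.
rewrite /AD_lmul (ktlift_sum (AD_lmulB a)).
by apply: eq_bigr => i _; rewrite (ktliftE (AD_lmulB a)).
Qed.

Lemma beta_balanced :
  balanced (fun (s : pinv_type) (a : A) => a * \val s)
    (fun (s : pinv_type) (b : A) => \val s * b)
    (fun a b => AD_lmul a (rho b)).
Proof.
split=> [a a' b|a b b'|s a b]; rewrite !AD_lmul_rho -?big_split;
  apply: eq_bigr => i _.
- by rewrite mulrDl kpureDl.
- by rewrite actDr mulrDr kpureDl.
- by rewrite (act_pinvM _ _ (valP s)) mulrA.
Qed.

Lemma betaE a b : beta (apure a b) = AD_lmul a (rho b).
Proof. exact: (tliftE beta_balanced). Qed.

Lemma AH_mulB1 (a : A) (b : A) (g : H) :
  kbalanced (fun h1 h2 : H => (a * (h1 · b)) ⊗ (h2 * g)).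
Proof.
split=> [m m' n|m n n'|c m n].
- by rewrite actDl mulrDr kpureDl.
- by rewrite mulrDl kpureDr.
- by rewrite actZl -scalerAr kpureZ -scalerAl.
Qed.

Lemma AH_mulB2 (a : A) (h : H) :
  kbalanced (fun (b : A) (g : H) =>
    \tsum_(h1, h2 <- comul h) ((a * (h1 · b)) ⊗ (h2 * g))).
Proof.
split=> [m m' n|m n n'|c m n]; rewrite /tlift -?big_split; apply: eq_bigr => p _.
- by rewrite actDr mulrDr kpureDl.
- by rewrite mulrDr kpureDr.
- by rewrite actZr -scalerAr kpureZ -scalerAr.
Qed.

Lemma AH_mulB3 (y : AH) :
  kbalanced (fun (a : A) (h : H) => \tsum_(b, g <- y)
    \tsum_(h1, h2 <- comul h) ((a * (h1 · b)) ⊗ (h2 * g))).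
Proof.
split=> [m m' n|m n n'|c m n]; rewrite /tlift -?big_split; apply: eq_bigr => p _.
- rewrite -big_split; apply: eq_bigr => q _.
  by rewrite mulrDl kpureDl.
- by rewrite linearD; exact: (ktliftD (AH_mulB1 _ _ _)).
- rewrite linearZ /=.
  have -> (u : ktens H H) : \sum_(q <- trep (c *: u))
     (m * (q.1 · p.1)) ⊗ (q.2 * p.2) = c *: \sum_(q <- trep u) (m * (q.1 · p.1)) ⊗ (q.2 * p.2).
    pose L (v : ktens H H) := \tsum_(h1, h2 <- v) ((m * (h1 · p.1)) ⊗ (h2 * p.2)).
    have LB := AH_mulB1 m p.1 p.2.
    rewrite -[LHS]/(L (c *: u)) -[RHS]/(c *: L u) /L.
    elim/ktens_ind: u => [|y1 z u IHu]; first by rewrite scaler0 !ktlift0 // scaler0.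
    have -> : c *: (y1 ⊗ z + u) = (c *: y1) ⊗ z + c *: u.
      by rewrite scalerDr; congr (_ + _); exact: kscaleE.
    rewrite !(ktliftD LB) IHu !(ktliftE LB) scalerDr; congr (_ + _).
    by rewrite actZl -scalerAr; apply/esym; exact: kscaleE.
  rewrite scaler_sumr; apply: eq_bigr => q _.
  by rewrite -scalerAl; apply/esym; exact: kscaleE.
Qed.

Lemma AH_mulE a h b g : AH_mul (a ⊗ h) (b ⊗ g) =
  \tsum_(h1, h2 <- comul h) ((a * (h1 · b)) ⊗ (h2 * g)).
Proof. by rewrite /AH_mul (ktliftE (AH_mulB3 _)) (ktliftE (AH_mulB2 _ _)). Qed.

Lemma AH_mul_suml (I : Type) (r : seq I) (F : I -> AH) y :
  AH_mul (\sum_(i <- r) F i) y = \sum_(i <- r) AH_mul (F i) y.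
Proof. exact: (ktlift_sum (AH_mulB3 y)). Qed.

Lemma smashE a h : smash a h = AH_mul (a ⊗ h) (1 ⊗ 1).
Proof. by rewrite AH_mulE /tlift; apply: eq_bigr => p _; rewrite mulr1. Qed.

Lemma smash1 a : smash a 1 = a ⊗ 1.
Proof.
by rewrite smashE AH_mulE comul1 (ktliftE (AH_mulB1 _ _ _)) pact1 !mulr1.
Qed.

Lemma AH_mul_tsum a b c h g :
  AH_mul (\tsum_(h1, h2 <- comul h) ((a * (h1 · b)) ⊗ h2)) (c ⊗ g) =
  \tsum_(h1, h2 <- comul h) ((a * (h1 · (b * c))) ⊗ (h2 * g)).
Proof.
rewrite {1}/tlift AH_mul_suml.
under eq_bigr do rewrite AH_mulE.
pose F x y z := (a * (x · b) * (y · c)) ⊗ (z * g).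
rewrite -[LHS]/(\tsum_(h1, h2 <- comul h) \tsum_(h21, h22 <- comul h2) F h1 h21 h22).
rewrite -comulA_lift.
- apply: eq_bigr => p _; rewrite pactM {2}/tlift mulr_sumr kpure_suml.
  by apply: eq_bigr => q _; rewrite /F mulrA.
- by move=> x; exact: AH_mulB1.
- by move=> x x' y z; rewrite /F actDl mulrDr mulrDl kpureDl.
- by move=> e x y z; rewrite /F !actZl -scalerAr -scalerAl -scalerAr.
Qed.

Lemma bracketE0 t a b :
  AH_mul (AH_mul (smash a 1) (smash 1 t)) (smash b 1) =
  \tsum_(t1, t2 <- comul t) ((a * (t1 · b)) ⊗ t2).
Proof.
rewrite !smash1.
have -> : AH_mul (a ⊗ 1) (smash 1 t) =
    \tsum_(t1, t2 <- comul t) ((a * (t1 · 1)) ⊗ t2).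
  rewrite /AH_mul (ktliftE (AH_mulB3 _)) /smash {2}/tlift.
  rewrite (ktlift_sum (AH_mulB2 _ _)); apply: eq_bigr => p _.
  rewrite (ktliftE (AH_mulB2 _ _)) comul1 (ktliftE (AH_mulB1 _ _ _)).
  by rewrite pact1 mulrA !mul1r mulr1.
by rewrite AH_mul_tsum mul1r; apply: eq_bigr => p _; rewrite mulr1.
Qed.

Lemma bracket_balanced t :
  balanced (fun (s : pinv_type) (a : A) => a * \val s)
    (fun (s : pinv_type) (b : A) => \val s * b)
    (fun a b => AH_mul (AH_mul (smash a 1) (smash 1 t)) (smash b 1)).
Proof.
split=> [a a' b|a b b'|s a b]; rewrite !bracketE0 /tlift -?big_split;
  apply: eq_bigr => p _.
- by rewrite mulrDl kpureDl.
- by rewrite actDr mulrDr kpureDl.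
- by rewrite (act_pinvM _ _ (valP s)) mulrA.
Qed.

Lemma bracketE t a b : bracket t (apure a b) =
  AH_mul (AH_mul (smash a 1) (smash 1 t)) (smash b 1).
Proof. exact: (tliftE (bracket_balanced t)). Qed.

Lemma bracket_smash t : set_fun setT smash_set (bracket t).
Proof.
have fB := AH_mulB3 (1 ⊗ 1).
suff e x : AH_mul (bracket t x) (1 ⊗ 1) = bracket t x.
  by move=> x _; exists (bracket t x).
elim/tens_ind: x => [|a b x IHx].
  by rewrite /bracket (tlift0 (bracket_balanced t)) [LHS](ktlift0 fB).
rewrite /bracket (tliftD (bracket_balanced t)) [LHS](ktliftD fB).
congr (_ + _); last exact: IHx.
rewrite -[LHS]/(AH_mul (bracket t (apure a b)) _) -[RHS]/(bracket t (apure a b)).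
rewrite bracketE bracketE0 AH_mul_tsum mulr1.
by apply: eq_bigr => p _; rewrite mulr1.
Qed.

Lemma AD_rmulB1 (a : A) (f : 'Hom(H, k^o)) :
  kbalanced (fun (b0 : A) (b1 : 'Hom(H, k^o)) => (a * b0) ⊗ (conv f b1)).
Proof.
split=> [m m' n|m n n'|c m n].
- by rewrite mulrDr kpureDl.
- by rewrite convDr kpureDr.
- by rewrite convZr -scalerAr kpureZ.
Qed.

Lemma AD_rmulB2 (b : A) :
  kbalanced (fun (a : A) (f : 'Hom(H, k^o)) =>
    \tsum_(b0, b1 <- rho b) ((a * b0) ⊗ (conv f b1))).
Proof.
split=> [m m' n|m n n'|c m n]; rewrite /tlift -?big_split; apply: eq_bigr => p _.
- by rewrite mulrDl kpureDl.
- by rewrite convDl kpureDr.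
- by rewrite convZl -scalerAl kpureZ.
Qed.

Lemma AD_rmul_pure a f b :
  AD_rmul (a ⊗ f) b = \sum_i (a * (hbasis i · b)) ⊗ conv f (hdual i).
Proof.
rewrite /AD_rmul (ktliftE (AD_rmulB2 b)) (ktlift_sum (AD_rmulB1 a f)).
by apply: eq_bigr => i _; rewrite (ktliftE (AD_rmulB1 a f)).
Qed.

Lemma AD_rmul_rho a b c : AD_rmul (AD_lmul a (rho b)) c = AD_lmul a (rho (b * c)).
Proof.
rewrite !AD_lmul_rho /AD_rmul (ktlift_sum (AD_rmulB2 c)).
under eq_bigr => i _ do rewrite -[tlift _ _]/(AD_rmul _ c) AD_rmul_pure.
under eq_bigr => i _ do under eq_bigr => j _ do
  rewrite [conv _ _]hdualE kpure_sumr.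
under eq_bigr => i _ do rewrite exchange_big.
rewrite exchange_big; apply: eq_bigr => l _ /=.
under eq_bigr => i _ do under eq_bigr => j _ do rewrite -kpureZ convE.
under eq_bigr => i _ do rewrite -kpure_suml.
rewrite -kpure_suml; congr (_ ⊗ _).
have act_sum h x : h · x = \sum_i (hdual i h : k) *: (hbasis i · x).
  rewrite {1}(hbasisE h).
  rewrite (big_morph (fun h => h · x) (fun h g => actDl h g x) (act0l x)).
  by apply: eq_bigr => i _; rewrite actZl.
rewrite pactM /tlift mulr_sumr.
under eq_bigr => i _ do under eq_bigr => j _ do rewrite scaler_suml.
under eq_bigr => i _ do rewrite exchange_big.
rewrite exchange_big; apply: eq_bigr => p _ /=.
rewrite (act_sum p.1) (act_sum p.2) mulr_suml mulr_sumr.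
apply: eq_bigr => i _; rewrite mulr_sumr mulr_sumr; apply: eq_bigr => j _.
by rewrite -scalerAl -!scalerAr scalerA mulrA.
Qed.

Lemma beta_AD1 : set_fun setT AD1 beta.
Proof.
have fB := AD_rmulB2 1.
suff e x : AD_rmul (beta x) 1 = beta x by move=> x _; exists (beta x).
elim/tens_ind: x => [|a b x IHx].
  by rewrite /beta (tlift0 beta_balanced) [LHS](ktlift0 fB).
rewrite /beta (tliftD beta_balanced) [LHS](ktliftD fB).
congr (_ + _); last exact: IHx.
rewrite -[LHS]/(AD_rmul (beta (apure a b)) _) -[RHS]/(beta (apure a b)).
by rewrite betaE AD_rmul_rho mulr1.
Qed.

End PartialAction.

Definition fin_gen (R : pzRingType) (M : lmodType R) : Prop :=
  exists (n : nat) (e : 'I_n -> M),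
    forall m : M, exists c : 'I_n -> R, m = \sum_i c i *: e i.

Definition projective (R : pzRingType) (M : lmodType R) : Prop :=
  forall (P Q : lmodType R) (p : {linear P -> Q}) (f : {linear M -> Q}),
    set_surj setT setT p ->
    exists g : {linear M -> P}, forall m, p (g m) = f m.

Definition fgp_right (k : fieldType) (H : hopfAlgType k) (A : algType k)
    (act : partial_action H A) : Prop :=
  fin_gen (A_right act) /\ projective (A_right act).

(* Main.v *)
(* Slicing the coproduct of [t] by [f] in its first factor gives
   [f(t_(1)) t_(2)]; these slices exhaust [H], and by transposition so do the
   slices in the second factor. Evaluating [A ⊗ H^*] at a slice
   [g(t_(2)) t_(1)] and [A # H] at [g], the equations [β(x) = (1 ⊗ f) 1_A] and
   [[x] = 1 # f(t_(1)) t_(2)] become the same, hence β is surjective iff the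
   bracket is. If [f(t_(1)) t_(2) = 1] and [β(Σ x_i ⊗ y_i) = (1 ⊗ f) 1_A], then
   [a = Σ x_i (t · (y_i a))] for every [a]: the [x_i] and [t · (y_i _)] are a
   finite dual basis of the right [A^H]-module [A], and since
   [(t · c) b = t_(1) · (c (S(t_(2)) · b))], they also make the kernel of β
   vanish. *)
From HB Require Import structures.
Require Import Defs.
From mathcomp Require Import all_boot all_order all_algebra all_field.
From mathcomp Require Import boolp classical_sets functions.
Import GRing.Theory.
Local Open Scope ring_scope.

Set Implicit Arguments.
Unset Strict Implicit.
Unset Printing Implicit Defensive.

(** * Computing with maps out of tensor products *)

Lemma tlift_add (S : Type) (M N V : zmodType) (ra : S -> M -> M)
    (la : S -> N -> N) (F G : M -> N -> V) (x : tens ra la) :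
  tlift (fun m n => F m n + G m n) x = tlift F x + tlift G x.
Proof. exact: big_split. Qed.

Lemma raddf_tlift (S : Type) (M N V W : zmodType) (ra : S -> M -> M)
    (la : S -> N -> N) (F : M -> N -> V) (f : {additive V -> W})
    (x : tens ra la) :
  f (tlift F x) = tlift (fun m n => f (F m n)) x.
Proof. exact: raddf_sum. Qed.

Lemma eq_tlift (S : Type) (M N V : zmodType) (ra : S -> M -> M)
    (la : S -> N -> N) (F G : M -> N -> V) (x : tens ra la) :
  (forall m n, F m n = G m n) -> tlift F x = tlift G x.
Proof. by move=> FG; apply: eq_bigr => p _; exact: FG. Qed.

(** A balanced map only induces an additive one. Scalars act on a tensor through its left factor, so
    homogeneity there suffices. *)
Lemma ktliftZ (k : fieldType) (M N V : lmodType k) (F : M -> N -> V) (c : k)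
    (x : ktens M N) :
  kbalanced F -> (forall a m n, F (a *: m) n = a *: F m n) ->
  tlift F (c *: x) = c *: tlift F x.
Proof.
move=> FB FZ; elim/ktens_ind: x => [|m n x IHx].
  by rewrite scaler0 (ktlift0 FB) scaler0.
have -> : c *: (kpure m n + x) = kpure (c *: m) n + c *: x.
  by rewrite scalerDr; congr (_ + _); exact: kscaleE.
by rewrite !(ktliftD FB) !(ktliftE FB) IHx FZ scalerDr.
Qed.

(** * Slices of the coproduct *)

Section Slices.
Variables (k : fieldType) (H : hopfAlgType k).
Implicit Types (f : 'Hom(H, k^o)) (h x y : H).

Definition lslice f h : H := \tsum_(h1, h2 <- comul h) ((f h1 : k) *: h2).

Lemma lsliceB f : kbalanced (fun h1 h2 : H => (f h1 : k) *: h2).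
Proof.
split=> [x x' y|x y y'|c x y]; rewrite ?scalerDr ?linearD ?scalerDl //.
by rewrite linearZ /= scalerA mulrC.
Qed.

Lemma lslice_linear f : linear (lslice f).
Proof.
move=> c x y; rewrite /lslice linearP (ktliftD (lsliceB f)); congr (_ + _).
apply: (ktliftZ _ _ (lsliceB f)) => a m n.
by rewrite linearZ scalerA.
Qed.
HB.instance Definition _ f :=
  GRing.isLinear.Build k H H _ (lslice f) (lslice_linear f).

Lemma lsliceDl f g h : lslice (f + g) h = lslice f h + lslice g h.
Proof.
by rewrite -tlift_add; apply: eq_tlift => x y; rewrite add_lfunE scalerDl.
Qed.

Lemma lslice_sum (I : Type) (r : seq I) (F : I -> 'Hom(H, k^o)) h :
  lslice (\sum_(i <- r) F i) h = \sum_(i <- r) lslice (F i) h.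
Proof.
have l0 : lslice 0 h = 0.
  by apply: (addrI (lslice 0 h)); rewrite -lsliceDl !addr0.
exact: (big_morph (fun f => lslice f h) (fun f g => lsliceDl f g h) l0).
Qed.

(** The twist of [f] by [h] for which slicing an integral becomes left H-linear, see
    [mul_lslice_integral]. *)
Definition lmul_form f h : 'Hom(H, k^o) := (f \o amull (antipode h))%VF.

Lemma lmul_formE f h x : lmul_form f h x = f (antipode h * x).
Proof. by rewrite comp_lfunE lfunE. Qed.

(** The right-hand side is f(S(h_(1)) h_(2) x_(1)) h_(3) x_(2), and S(h_(1)) h_(2) cancels to the
    counit. *)
Lemma lslice_mul f h x :
  h * lslice f x =
  \tsum_(h1, h2 <- comul h) lslice (lmul_form f h1) (h2 * x).
Proof.
pose F x y z : H := (f (antipode x * y) : k) *: z.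
have FB a : kbalanced (F a).
  split=> [y y' z|y z z'|c y z]; rewrite /F.
  - by rewrite mulrDr linearD scalerDl.
  - by rewrite scalerDr.
  - by rewrite -scalerAr linearZ /= scalerA mulrC.
(* Coassociativity is applied to [h] only; the coproduct of [x] rides along inside [F']. *)
pose F' a y z := \tsum_(x1, x2 <- comul x) F a (y * x1) (z * x2).
have -> : \tsum_(h1, h2 <- comul h) lslice (lmul_form f h1) (h2 * x) =
    \tsum_(h1, h2 <- comul h) \tsum_(h21, h22 <- comul h2) F' h1 h21 h22.
  apply: eq_tlift => a b.
  transitivity (tlift (F a) (comul (b * x))).
    by apply: eq_tlift => y z; rewrite lmul_formE.
  rewrite comulM (ktlift_tsum (FB a)); apply: eq_tlift => b1 b2.
  rewrite (ktlift_tsum (FB a)); apply: eq_tlift => x1 x2.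
  by rewrite (ktliftE (FB a)).
rewrite -comulA_lift.
- transitivity (\tsum_(h1, h2 <- comul h) \tsum_(x1, x2 <- comul x)
     (((counit h1 : k) * (f x1 : k)) *: (h2 * x2))).
    rewrite -{1}[h]counitl /tlift mulr_suml; apply: eq_bigr => p _.
    rewrite /lslice -scalerAl mulr_sumr scaler_sumr; apply: eq_bigr => q _.
    by rewrite -scalerAr scalerA.
  apply: eq_tlift => a b.
  rewrite /tlift exchange_big; apply: eq_bigr => q _ /=.
  rewrite /F -scaler_suml; congr (_ *: _).
  have ea : (\sum_(i <- trep (comul a)) antipode i.1 * i.2) * q.1 =
      (counit a : k) *: q.1.
    by rewrite -(mulr_algl (counit a : k)) -antipodel.
  apply/esym; transitivity (f ((counit a : k) *: q.1) : k).
    rewrite -ea mulr_suml linear_sum; apply: eq_bigr => p _.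
    by rewrite mulrA.
  by rewrite linearZ.
- move=> a; split=> [y y' z|y z z'|c y z]; rewrite /F' -?tlift_add;
    apply: eq_tlift => u v; rewrite /F.
  + by rewrite mulrDl mulrDr linearD scalerDl.
  + by rewrite mulrDl scalerDr.
  + by rewrite -!scalerAl -scalerAr linearZ /= scalerA mulrC.
- move=> a a' y z; rewrite /F' -tlift_add; apply: eq_tlift => u v.
  by rewrite /F linearD mulrDl linearD scalerDl.
- move=> c a y z; rewrite /F'; apply: eq_tlift => u v.
  by rewrite /F linearZ -!scalerAl -scalerAr.
Qed.

Lemma lmul_formD f x y : lmul_form f (x + y) = lmul_form f x + lmul_form f y.
Proof.
by apply/lfunP=> z; rewrite add_lfunE !lmul_formE linearD mulrDl linearD.
Qed.

Lemma lmul_formZ f c x : lmul_form f (c *: x) = c *: lmul_form f x.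
Proof.
by apply/lfunP=> z; rewrite scale_lfunE !lmul_formE linearZ -scalerAl linearZ.
Qed.

Lemma lsliceZl c f h : lslice (c *: f) h = c *: lslice f h.
Proof.
rewrite /lslice /tlift scaler_sumr; apply: eq_bigr => p _.
by rewrite scale_lfunE scalerA.
Qed.

(** This turns the convolution in the right action on A ⊗ H^* into a slice. *)
Lemma conv_lslice f g h : conv f g h = g (lslice f h).
Proof.
rewrite convE /lslice /tlift linear_sum; apply: eq_bigr => p _.
by rewrite linearZ.
Qed.

Definition rslice f h : H := \tsum_(h1, h2 <- comul h) ((f h2 : k) *: h1).

Lemma rsliceB f : kbalanced (fun h1 h2 : H => (f h2 : k) *: h1).
Proof.
split=> [x x' y|x y y'|c x y]; rewrite ?scalerDr ?linearD ?scalerDl //.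
by rewrite scalerA mulrC linearZ.
Qed.

Lemma rslice_linear f : linear (rslice f).
Proof.
move=> c x y; rewrite /rslice linearP (ktliftD (rsliceB f)); congr (_ + _).
by apply: (ktliftZ _ _ (rsliceB f)) => a m n; rewrite !scalerA mulrC.
Qed.
HB.instance Definition _ f :=
  GRing.isLinear.Build k H H _ (rslice f) (rslice_linear f).

(** By coassociativity both sides are f(h_(1)) g(h_(3)) h_(2). *)
Lemma rslice_lslice f g h : rslice g (lslice f h) = lslice f (rslice g h).
Proof.
pose F x y z : H := (f x * g z : k) *: y.
have -> : rslice g (lslice f h) =
    \tsum_(h1, h2 <- comul h) rslice g ((f h1 : k) *: h2) by exact: raddf_tlift.
have -> : lslice f (rslice g h) =
    \tsum_(h1, h2 <- comul h) lslice f ((g h2 : k) *: h1) by exact: raddf_tlift.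
transitivity (\tsum_(h1, h2 <- comul h)
    \tsum_(h21, h22 <- comul h2) F h1 h21 h22).
  apply: eq_tlift => x y; rewrite linearZ /= /rslice /tlift scaler_sumr.
  by apply: eq_bigr => p _; rewrite scalerA.
rewrite -comulA_lift.
- apply: eq_tlift => x y; rewrite linearZ /= /lslice /tlift scaler_sumr.
  by apply: eq_bigr => p _; rewrite scalerA mulrC.
- move=> x; split=> [y y' z|y z z'|c y z]; rewrite /F.
  + by rewrite scalerDr.
  + by rewrite linearD mulrDr scalerDl.
  + by rewrite scalerA -mulrA [_ * c]mulrC linearZ.
- by move=> x x' y z; rewrite /F linearD mulrDl scalerDl.
- move=> c x y z; rewrite /F scalerA mulrAC [_ * c]mulrC.
  by congr ((_ * _) *: _); rewrite linearZ.
Qed.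

(** * Slices of a left integral exhaust the Hopf algebra *)

Section Integral.
Variable t : H.
Hypothesis t_integral : left_integral t.

(* The slice by [f] of [t_(1) ⊗ h t_(2) = S(h) t_(1) ⊗ t_(2)]. *)
Lemma mul_lslice_integral f h : h * lslice f t = lslice (lmul_form f h) t.
Proof.
rewrite lslice_mul.
transitivity (\tsum_(h1, h2 <- comul h)
    lslice (lmul_form f ((counit h2 : k) *: h1)) t).
  apply: eq_tlift => x y.
  by rewrite t_integral linearZ /= lmul_formZ lsliceZl.
have l0 : lmul_form f 0 = 0.
  by apply: (addrI (lmul_form f 0)); rewrite -lmul_formD !addr0.
rewrite /tlift -lslice_sum -(big_morph (lmul_form f) (lmul_formD f) l0).
by congr (lslice (lmul_form f _) t); exact: counitr.
Qed.

(* The slices form a left ideal, and if [f t = 1] then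
   [1 = f(t_(1)) S(t_(2)) t_(3)] belongs to it. *)
Lemma lslice_integral_surj : t <> 0 -> forall h, exists f, lslice f t = h.
Proof.
move=> t0 h.
suff [f f1] : exists f, lslice f t = 1.
  by exists (lmul_form f h); rewrite -mul_lslice_integral f1 mulr1.
have [f ft] : exists f : 'Hom(H, k^o), f t = 1.
  have [[i it]|ht0] := pselect (exists i, hdual i t <> 0).
    exists ((hdual i t : k)^-1 *: hdual i).
    by rewrite scale_lfunE; apply: mulVf; apply/eqP.
  case: t0; rewrite [t]hbasisE big1 // => i _.
  have -> : hdual i t = 0 by apply: contra_notP ht0 => ?; exists i.
  by rewrite scale0r.
pose G x := antipode (lslice f x).
have G_unit : \tsum_(t1, t2 <- comul t) (G t1 * t2) = 1.
  pose F x y z : H := ((f x : k) *: antipode y) * z.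
  transitivity (\tsum_(t1, t2 <- comul t)
      \tsum_(t11, t12 <- comul t1) F t11 t12 t2).
    apply: eq_tlift => x y; rewrite /G /lslice raddf_tlift /tlift mulr_suml.
    by apply: eq_bigr => p _; rewrite /= linearZ.
  rewrite comulA_lift.
  (* Here S(t_(2)) t_(3) collapses to the counit, leaving f(t) = 1. *)
  - transitivity (\tsum_(t1, t2 <- comul t) ((f t1 * counit t2 : k)%:A : H)).
      apply: eq_tlift => x y; rewrite -scalerA -antipodel /tlift scaler_sumr.
      by apply: eq_bigr => p _; rewrite /F scalerAl.
    rewrite /tlift -scaler_suml.
    have -> : \sum_(i <- trep (comul t)) f i.1 * counit i.2 = f t :> k.
      rewrite -{2}[t]counitr linear_sum; apply: eq_bigr => p _.
      by rewrite linearZ /=; exact: mulrC.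
    by rewrite ft scale1r.
  - move=> x; split=> [y y' z|y z z'|c y z]; rewrite /F.
    + by rewrite linearD scalerDr mulrDl.
    + by rewrite mulrDr.
    + by rewrite linearZ /= -!scalerAl -scalerAr.
  - by move=> x x' y z; rewrite /F linearD scalerDl mulrDl.
  - move=> c x y z; rewrite /F !linearZ /= scalerA.
    by congr (_ *: _ * _); exact: mulrC.
(* The coordinate forms of [G]. They rewrite G(t_(1)) t_(2) as the sum of the products of [hbasis i]
   with the slice of [t] by [g i], each of which is again a slice. *)
pose g i : 'Hom(H, k^o) :=
  (hdual i \o linfun (antipode \o lslice f)%FUN)%VF.
have gE i x : g i x = hdual i (G x).
  by rewrite comp_lfunE; congr (hdual i _); rewrite lfunE.
exists (\sum_i lmul_form (g i) (hbasis i)).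
rewrite lslice_sum -G_unit.
under eq_bigr => i _ do
  rewrite -mul_lslice_integral /lslice {1}/tlift mulr_sumr.
rewrite exchange_big; apply: eq_bigr => p _ /=.
rewrite [G p.1]hbasisE mulr_suml; apply: eq_bigr => i _.
by rewrite gE -scalerAl -scalerAr.
Qed.

(** This is the transposition between the two kinds of slices: the coordinates of a left slice by
    [f] are the values of [f] at the right slices by the dual basis. *)
Lemma lslice_basisE f :
  lslice f t = \sum_i (f (rslice (hdual i) t) : k) *: hbasis i.
Proof.
rewrite {1}/lslice /tlift.
under eq_bigr => p _ do rewrite {1}[p.2]hbasisE scaler_sumr.
rewrite exchange_big; apply: eq_bigr => i _ /=.
rewrite /rslice linear_sum scaler_suml; apply: eq_bigr => p _.
by rewrite scalerA [_ * _]mulrC linearZ.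
Qed.

(** A form whose left slice of [t] is the i-th basis vector takes the value 1 on the i-th right
    slice and 0 on the others. Such forms exist for every i, so the right slices are free, and there
    are dim H of them. *)
Lemma rslice_hdual_basis : t <> 0 ->
  basis_of {:H} [tuple rslice (hdual i) t | i < \dim {:H}].
Proof.
move=> t0.
rewrite basisEfree subvf size_tuple leqnn !andbT.
apply/freeP => c c0 i.
have [f fi] := lslice_integral_surj t0 (hbasis i).
have e : forall j, f (rslice (hdual j) t) = (j == i)%:R.
  move=> j; have := congr1 (hdual j) fi.
  have hb l m : hdual l (hbasis m) = (m == l)%:R :> k.
    by rewrite lfunE /= /hbasis (coord_free _ _ (basis_free (vbasisP _))).
  rewrite lslice_basisE linear_sum hb [i == j]eq_sym => <-.
  rewrite (bigD1 j) //= linearZ /= hb eqxx big1 ?addr0.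
    by rewrite [RHS]mulr1.
  by move=> l /negbTE lj; rewrite linearZ /= hb lj; exact: mulr0.
(* Applying [f] to the vanishing combination isolates the coefficient [c i]. *)
have := congr1 f c0; rewrite linear0 linear_sum (bigD1 i) //= big1 => [|j ji].
  rewrite addr0 linearZ /= (nth_mktuple _ 0) e eqxx => <-.
  exact: esym (mulr1 _).
by rewrite linearZ /= (nth_mktuple _ 0) e (negbTE ji); exact: mulr0.
Qed.

End Integral.
End Slices.

(** * Evaluating the canonical map and the bracket in A *)

Section Evaluation.
Variables (k : fieldType) (H : hopfAlgType k) (A : algType k).
Variable act : partial_action H A.
Local Notation "h · a" := (act h a) (at level 39).
Implicit Types (f g : 'Hom(H, k^o)) (h : H) (a b c : A).

Lemma act_suml (I : Type) (r : seq I) (F : I -> H) a :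
  (\sum_(i <- r) F i) · a = \sum_(i <- r) F i · a.
Proof.
have aD : {morph act^~ a : h h' / h + h'} by move=> h h'; exact: actDl.
exact: (big_morph _ aD (act0l act a)).
Qed.

Lemma act_sumr (I : Type) (r : seq I) (F : I -> A) h :
  h · (\sum_(i <- r) F i) = \sum_(i <- r) h · F i.
Proof. exact: (big_morph _ (actDr act h) (act0r act h)). Qed.

Definition eval_dual h (x : ktens A 'Hom(H, k^o)) : A :=
  \tsum_(a, f <- x) ((f h : k) *: a).

Lemma eval_dualB h : kbalanced (fun a f => (f h : k) *: a).
Proof.
split=> [x x' f|x f f'|c x f]; rewrite ?scalerDr ?add_lfunE ?scalerDl //.
by rewrite scale_lfunE scalerA mulrC.
Qed.

Lemma eval_dualD h x y : eval_dual h (x + y) = eval_dual h x + eval_dual h y.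
Proof. exact: (ktliftD (eval_dualB h)). Qed.

Lemma eval_dual_pure h a f : eval_dual h (kpure a f) = (f h : k) *: a.
Proof. exact: (ktliftE (eval_dualB h)). Qed.

Lemma eval_dual0 h : eval_dual h 0 = 0.
Proof. exact: (ktlift0 (eval_dualB h)). Qed.

(** Rebuilding a tensor from its values at a basis of H allows identities in A ⊗ H^* to be checked
    in A. *)
Lemma eval_dualK x : \sum_i kpure (eval_dual (hbasis i) x) (hdual i) = x.
Proof.
elim/ktens_ind: x => [|a f x IHx].
  rewrite big1 // => i _; rewrite eval_dual0.
  by apply: (addrI (kpure 0 (hdual i))); rewrite -kpureDl !addr0.
rewrite -[in RHS]IHx {2}[f]hdualE kpure_sumr -big_split.
by apply: eq_bigr => i _; rewrite eval_dualD eval_dual_pure kpureDl kpureZ.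
Qed.

Lemma eval_dual_inj x y : (forall h, eval_dual h x = eval_dual h y) -> x = y.
Proof.
move=> xy; rewrite -[x]eval_dualK -[y]eval_dualK.
by apply: eq_bigr => i _; rewrite xy.
Qed.

Lemma eval_dual_lmul h a x : eval_dual h (AD_lmul a x) = a * eval_dual h x.
Proof.
elim/ktens_ind: x => [|b f x IHx].
  by rewrite /AD_lmul (ktlift0 (AD_lmulB H a)) !eval_dual0 mulr0.
rewrite /AD_lmul (ktliftD (AD_lmulB H a)) (ktliftE (AD_lmulB H a)).
by rewrite !eval_dualD IHx !eval_dual_pure mulrDr scalerAr.
Qed.

Lemma eval_dual_rmul1 h a f :
  eval_dual h (AD_rmul act (kpure a f) 1) = a * (lslice f h · 1).
Proof.
rewrite AD_rmul_pure /eval_dual (ktlift_sum (eval_dualB h)) [lslice f h]hbasisE.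
rewrite act_suml mulr_sumr; apply: eq_bigr => i _.
by rewrite (ktliftE (eval_dualB h)) conv_lslice actZl scalerAr.
Qed.

Definition eval_hopf f (x : ktens A H) : A :=
  \tsum_(a, h <- x) ((f h : k) *: a).

Lemma eval_hopfB f : kbalanced (fun (a : A) h => (f h : k) *: a).
Proof.
split=> [x x' h|x h h'|c x h]; rewrite ?scalerDr ?linearD ?scalerDl //.
by rewrite scalerA mulrC linearZ.
Qed.

Lemma eval_hopf_inj x y : (forall f, eval_hopf f x = eval_hopf f y) -> x = y.
Proof.
(* The counterpart of [eval_dualK], with the roles of the basis and the dual basis exchanged. *)
have K z : \sum_i kpure (eval_hopf (hdual i) z) (hbasis i) = z.
  elim/ktens_ind: z => [|a h z IHz].
    rewrite big1 // => i _; rewrite /eval_hopf (ktlift0 (eval_hopfB _)).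
    by apply: (addrI (kpure 0 (hbasis i))); rewrite -kpureDl !addr0.
  rewrite -[in RHS]IHz {2}[h]hbasisE kpure_sumr -big_split.
  apply: eq_bigr => i _.
  by rewrite /eval_hopf (ktliftD (eval_hopfB _)) (ktliftE (eval_hopfB _))
    kpureDl kpureZ.
by move=> xy; rewrite -[x]K -[y]K; apply: eq_bigr => i _; rewrite xy.
Qed.

Lemma eval_hopf_smash f a h :
  eval_hopf f (smash act a h) = a * (rslice f h · 1).
Proof.
rewrite {1}/eval_hopf (ktlift_tsum (eval_hopfB f)) /rslice.
rewrite [in RHS]/tlift act_suml mulr_sumr; apply: eq_bigr => p _.
by rewrite (ktliftE (eval_hopfB f)) actZl scalerAr.
Qed.

(** The common value through which β and the bracket are compared: β(x) evaluates to it at [h], and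
    the bracket of x evaluates to it at a form whose right slice of [t] is [h]. *)
Definition pairing h (x : AtensA act) : A := \tsum_(a, b <- x) (a * (h · b)).

Lemma pairingB h :
  balanced (fun (s : pinv_type act) a => a * \val s)
    (fun (s : pinv_type act) b => \val s * b) (fun a b => a * (h · b)).
Proof.
split=> [a a' b|a b b'|s a b].
- by rewrite mulrDl.
- by rewrite actDr mulrDr.
- by rewrite (act_pinvM _ _ (valP s)) mulrA.
Qed.

Lemma pairing_suml (I : Type) (r : seq I) (F : I -> H) x :
  pairing (\sum_(i <- r) F i) x = \sum_(i <- r) pairing (F i) x.
Proof.
rewrite [RHS]exchange_big; apply: eq_bigr => p _.
by rewrite act_suml mulr_sumr.
Qed.

Lemma pairingZl e h x : pairing (e *: h) x = e *: pairing h x.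
Proof.
rewrite /pairing /tlift scaler_sumr; apply: eq_bigr => p _.
by rewrite actZl scalerAr.
Qed.

Lemma eval_dual_beta h x : eval_dual h (beta x) = pairing h x.
Proof.
rewrite -[beta x]/(\sum_(p <- trep x) AD_lmul p.1 (rho act p.2)).
rewrite /eval_dual (ktlift_sum (eval_dualB h)).
apply: eq_bigr => p _.
rewrite -[LHS]/(eval_dual h _) eval_dual_lmul.
by congr (_ * _); exact: esym (rhoE act h p.2).
Qed.

Lemma eval_hopf_bracket t f x :
  eval_hopf f (bracket t x) = pairing (rslice f t) x.
Proof.
rewrite -[bracket t x]/(\sum_(p <- trep x) AH_mul act
  (AH_mul act (smash act p.1 1) (smash act 1 t)) (smash act p.2 1)).
rewrite /eval_hopf (ktlift_sum (eval_hopfB f)).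
apply: eq_bigr => p _.
rewrite bracketE0 (ktlift_tsum (eval_hopfB f)) /rslice [in RHS]/tlift act_suml.
rewrite mulr_sumr; apply: eq_bigr => q _.
by rewrite (ktliftE (eval_hopfB f)) actZl scalerAr.
Qed.

Lemma pairing_lmul h c x : pairing h (AtensA_lmul c x) = c * pairing h x.
Proof.
rewrite -[AtensA_lmul c x]/(\sum_(p <- trep x) apure act (c * p.1) p.2).
rewrite /pairing (tlift_sum (pairingB h)) [in RHS]/tlift mulr_sumr.
by apply: eq_bigr => p _; rewrite (tliftE (pairingB h)) mulrA.
Qed.

Lemma betaD : {morph @beta k H A act : x y / x + y}.
Proof. exact: (tliftD (beta_balanced act)). Qed.

Lemma beta_lmul c (x : AtensA act) :
  beta (AtensA_lmul c x) = AD_lmul c (beta x).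
Proof.
apply: eval_dual_inj => h.
by rewrite eval_dual_lmul !eval_dual_beta pairing_lmul.
Qed.

(** On pure tensors this is the multiplicativity of the coaction, in the form [AD_rmul_rho]. *)
Lemma beta_rmul (x : AtensA act) c :
  beta (AtensA_rmul x c) = AD_rmul act (beta x) c.
Proof.
rewrite -[AtensA_rmul x c]/(\sum_(p <- trep x) apure act p.1 (p.2 * c)).
rewrite -[beta x]/(\sum_(p <- trep x) AD_lmul p.1 (rho act p.2)).
rewrite {1}/beta (tlift_sum (beta_balanced act)).
rewrite /AD_rmul (ktlift_sum (AD_rmulB2 act c)).
apply: eq_bigr => p _.
by rewrite -[LHS]/(beta (apure act _ _)) betaE -AD_rmul_rho.
Qed.

End Evaluation.

(** * The antipode and the partial trace a ↦ t · a *)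

Section PartialTrace.
Variables (k : fieldType) (H : hopfAlgType k) (A : algType k).
Variable act : partial_action H A.
Local Notation "h · a" := (act h a) (at level 39).
Implicit Types (f : 'Hom(H, k^o)) (h : H) (a b c : A).

(** Composing the two actions gives (h_(1) · 1)(h_(2) S(h_(3)) · b), where the antipode cancels. *)
Lemma act_antipode h b :
  \tsum_(h1, h2 <- comul h) (h1 · (antipode h2 · b)) = (h · 1) * b.
Proof.
pose F x y z := (x · 1) * ((y * antipode z) · b).
transitivity (\tsum_(h1, h2 <- comul h) \tsum_(h11, h12 <- comul h1)
    F h11 h12 h2).
  by apply: eq_tlift => x y; exact: pactA.
rewrite comulA_lift.
- transitivity (\tsum_(h1, h2 <- comul h) (((counit h2 : k) *: h1) · 1 * b)).
    apply: eq_tlift => x y; rewrite /F /tlift -mulr_sumr -act_suml.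
    rewrite -[\sum_(i <- _) _]/(\tsum_(y1, y2 <- comul y) (y1 * antipode y2)).
    by rewrite antipoder !actZl pact1 -scalerAl -scalerAr.
  by rewrite /tlift -mulr_suml -act_suml; congr (_ · _ * _); exact: counitr.
- move=> x; split=> [y y' z|y z z'|c y z]; rewrite /F.
  + by rewrite mulrDl actDl mulrDr.
  + by rewrite linearD mulrDr actDl mulrDr.
  + by rewrite linearZ -scalerAl -scalerAr.
- by move=> x x' y z; rewrite /F actDl mulrDl.
- by move=> c x y z; rewrite /F -!scalerAl !actZl -scalerAl -scalerAr.
Qed.

(** Expanding the action on the product gives (h_(1) · c)(h_(2) · (S(h_(3)) · b)). By [act_antipode]
    this is (h_(1) · c)(h_(2) · 1) b, whose first two factors recombine to h · c. *)
Lemma act_mul_antipode h c b :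
  (h · c) * b = \tsum_(h1, h2 <- comul h) (h1 · (c * (antipode h2 · b))).
Proof.
pose F x y z := (x · c) * (y · (antipode z · b)).
transitivity (\tsum_(h1, h2 <- comul h) \tsum_(h11, h12 <- comul h1)
    F h11 h12 h2); last by apply: eq_tlift => x y; rewrite pactM.
rewrite comulA_lift.
- rewrite -{1}[c]mulr1 pactM /tlift mulr_suml; apply: eq_bigr => p _.
  rewrite -mulrA -act_antipode /tlift mulr_sumr.
  by apply: eq_bigr.
- move=> x; split=> [y y' z|y z z'|e y z]; rewrite /F.
  + by rewrite actDl mulrDr.
  + by rewrite linearD actDl actDr mulrDr.
  + by rewrite linearZ !actZl actZr.
- by move=> x x' y z; rewrite /F actDl mulrDl.
- by move=> e x y z; rewrite /F !actZl -scalerAl -scalerAr.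
Qed.

Hypothesis act1_central : forall h a, h · 1 * a = a * (h · 1).
Variable t : H.
Hypothesis t_integral : left_integral t.

(** Since h_(2) t is the counit of h_(2) times t, h · (t · a) = (h · 1)(t · a); centrality moves h ·
    1 to the right. *)
Lemma act_integral_pinv a : t · a \in Defs.pinv act.
Proof.
apply/pinvP => h; rewrite -act1_central pactA.
transitivity (\tsum_(h1, h2 <- comul h)
    (((counit h2 : k) *: h1) · 1 * (t · a))).
  by apply: eq_tlift => x y; rewrite t_integral !actZl -scalerAl -scalerAr.
by rewrite /tlift -mulr_suml -act_suml; congr (_ · _ * _); exact: counitr.
Qed.

Definition partial_trace a : pinv_type act := PInv (act_integral_pinv a).

(** Left linearity over the invariants is built into their definition; on the right, h_(2) · s = s
    (h_(2) · 1) and centrality of h_(2) · 1 gives the result. It makes the partial trace right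
    linear. *)
Lemma act_mul_pinv h a (s : pinv_type act) : h · (a * \val s) = h · a * \val s.
Proof.
have /pinvP sP := valP s.
rewrite -{2}[a]mulr1 !pactM /tlift mulr_suml; apply: eq_bigr => p _.
by rewrite sP -act1_central mulrA.
Qed.

(** * A dual basis from one preimage under β *)

Section DualBasis.
Variables (f : 'Hom(H, k^o)) (x : AtensA act).
Hypothesis ft : lslice f t = 1.
Hypothesis fx : beta x = AD_rmul act (kpure 1 f) 1.

Lemma pairing_preimage h : pairing h x = lslice f h · 1.
Proof. by rewrite -eval_dual_beta fx eval_dual_rmul1 mul1r. Qed.

(** The left side is Σ u (t_(1) · v)(t_(2) · a). The choice of [x] turns Σ u (t_(1) · v) into the
    action on 1 of the slice of t_(1) by [f], giving f(t_(1)) (t_(2) · 1)(t_(3) · a) = f(t_(1))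
    (t_(2) · a), and [ft] leaves a. *)
Lemma trace_dual_basis a : \tsum_(u, v <- x) (u * (t · (v * a))) = a.
Proof.
transitivity (\tsum_(t1, t2 <- comul t) (pairing t1 x * (t2 · a))).
  rewrite {1}/tlift.
  under eq_bigr => p _ do
    rewrite pactM [tlift _ _ in X in _ * X]/tlift mulr_sumr.
  rewrite exchange_big; apply: eq_bigr => q _ /=.
  by rewrite mulr_suml; apply: eq_bigr => p _; rewrite mulrA.
pose F y z w := ((f y : k) *: (z · 1)) * (w · a).
transitivity (\tsum_(t1, t2 <- comul t) \tsum_(t11, t12 <- comul t1)
    F t11 t12 t2).
  apply: eq_tlift => y z; rewrite pairing_preimage /lslice /tlift.
  by rewrite act_suml mulr_suml; apply: eq_bigr => p _; rewrite actZl.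
rewrite comulA_lift.
- transitivity (\tsum_(t1, t2 <- comul t) (((f t1 : k) *: t2) · a)).
    apply: eq_tlift => y z; rewrite actZl -{1}[a]mul1r pactM /tlift scaler_sumr.
    by apply: eq_bigr => p _; rewrite /F scalerAl.
  by rewrite /tlift -act_suml -[RHS](pact1 act) -ft.
- move=> y; split=> [z z' w|z w w'|c z w]; rewrite /F.
  + by rewrite actDl scalerDr mulrDl.
  + by rewrite actDl mulrDr.
  + by rewrite !actZl -!scalerAl -scalerAr.
- by move=> y y' z w; rewrite /F linearD scalerDl mulrDl.
- by move=> c y z w; rewrite /F linearZ actZl scalerA mulrC.
Qed.

Lemma fgp_right_of_dual_basis : fgp_right act.
Proof.
pose u (i : 'I_(size (trep x))) : A := (nth (0, 0) (trep x) i).1.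
pose v (i : 'I_(size (trep x))) : A := (nth (0, 0) (trep x) i).2.
have uvE a : \sum_i u i * \val (partial_trace (v i * a)) = a.
  by rewrite -{2}[a]trace_dual_basis /tlift (big_nth (0, 0)) big_mkord.
split.
  exists (size (trep x)), (u : 'I__ -> A_right act) => a.
  by exists (fun i => partial_trace (v i * a)); rewrite -[LHS]uvE.
move=> P Q p g p_surj.
have /choice[q qP] : forall i, exists y, p y = g (u i).
  by move=> i; have [y _ yP] := p_surj (g (u i)) I; exists y.
(* The lift sends each generator's coefficient, the trace of [v i * a], to the chosen preimage [q i]
   of [g (u i)]. *)
pose G (a : A_right act) : P :=
  \sum_i (partial_trace (v i * a) : (pinv_type act)^c) *: q i.
have G_linear : linear G.
  move=> s a b; rewrite /G scaler_sumr -big_split; apply: eq_bigr => i _ /=.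
  rewrite scalerA -scalerDl; congr (_ *: _); apply: val_inj => /=.
  by rewrite mulrDr actDr mulrA act_mul_pinv.
pose GL := GRing.isLinear.Build _ _ _ _ G G_linear.
pose GG : {linear A_right act -> P} := HB.pack G GL.
exists GG => a; rewrite -[GG a]/(G a) /G linear_sum -[a in RHS]uvE linear_sum.
by apply: eq_bigr => i _; rewrite linearZ qP -linearZ.
Qed.

(** For z = Σ a ⊗ b in the kernel, each a is expanded as Σ u (t · (v a)). The traces are invariant
    and cross the tensor sign, so z = Σ u ⊗ Σ (t · (v a)) b, and the inner sums vanish. *)
Lemma beta_inj : injective (@beta k H A act).
Proof.
suff ker0 (z : AtensA act) : beta z = 0 -> z = 0.
  move=> z z' zz'; apply/eqP; rewrite -subr_eq0; apply/eqP/ker0.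
  by apply: (addIr (beta z')); rewrite -betaD subrK add0r.
move=> z0.
have pz h : pairing h z = 0 by rewrite -eval_dual_beta z0 eval_dual0.
have z_sum y : \tsum_(a, b <- z) ((t · (y * a)) * b) = 0.
  (* [act_mul_antipode] gathers the sum over [z] into values of β(z), all of which are zero. *)
  transitivity (\tsum_(t1, t2 <- comul t) (t1 · (y * pairing (antipode t2) z))).
    rewrite {1}/tlift.
    under eq_bigr => p _ do rewrite act_mul_antipode {1}/tlift.
    rewrite exchange_big; apply: eq_bigr => q _ /=.
    rewrite /pairing /tlift mulr_sumr act_sumr; apply: eq_bigr => p _.
    by rewrite mulrA.
  by rewrite /tlift big1 // => q _; rewrite pz mulr0 act0r.
have apure0r a : apure act a 0 = 0.
  by apply: (addrI (apure act a 0)); rewrite -[LHS]tpureDr !addr0.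
have apure0l b : apure act 0 b = 0.
  by apply: (addrI (apure act 0 b)); rewrite -[LHS]tpureDl !addr0.
have apure_sumr (a : A) (I : Type) (r : seq I) (F : I -> A) :
    apure act a (\sum_(i <- r) F i) = \sum_(i <- r) apure act a (F i).
  by apply: (big_morph _ _ (apure0r a)) => b b'; exact: tpureDr.
have apure_suml (b : A) (I : Type) (r : seq I) (F : I -> A) :
    apure act (\sum_(i <- r) F i) b = \sum_(i <- r) apure act (F i) b.
  by apply: (big_morph (apure act ^~ b) _ (apure0l b)) => a a'; exact: tpureDl.
transitivity (\sum_(p <- trep x)
    apure act p.1 (\tsum_(a, b <- z) ((t · (p.2 * a)) * b))).
  rewrite [LHS]tens_repE.
  under [RHS]eq_bigr => p _ do rewrite /tlift apure_sumr.
  rewrite exchange_big; apply: eq_bigr => q _ /=.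
  rewrite -{1}[q.1]trace_dual_basis [LHS]apure_suml; apply: eq_bigr => p _.
  exact: (tpure_bal _ _ (partial_trace (p.2 * q.1))).
by rewrite big1 // => p _; rewrite z_sum apure0r.
Qed.

End DualBasis.
End PartialTrace.

(** * Comparing the two surjectivity conditions *)

Section Equivalence.
Variables (k : fieldType) (H : hopfAlgType k) (A : algType k).
Variable act : partial_action H A.
Variable t : H.
Hypotheses (t_integral : left_integral t) (t_neq0 : t <> 0).

(** Evaluated at [g], the bracket equation is the β equation evaluated at the right slice of [t] by
    [g], because left and right slices commute. *)
Lemma beta_bracket (x : AtensA act) f :
  beta x = AD_rmul act (kpure 1 f) 1 <-> bracket t x = smash act 1 (lslice f t).
Proof.
split=> e.
  apply: eval_hopf_inj => g; rewrite eval_hopf_bracket -eval_dual_beta e.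
  by rewrite eval_dual_rmul1 eval_hopf_smash rslice_lslice.
have pE i : pairing (rslice (hdual i) t) x =
    act (lslice f (rslice (hdual i) t)) 1.
  by rewrite -eval_hopf_bracket e eval_hopf_smash mul1r rslice_lslice.
apply: eval_dual_inj => h; rewrite eval_dual_beta eval_dual_rmul1 mul1r.
have bX := rslice_hdual_basis t_integral t_neq0.
(* [pE] gives the β equation at right slices only; since these form a basis, linearity extends it to
   every [h]. *)
rewrite (coord_basis bX (memvf h)) pairing_suml linear_sum act_suml.
apply: eq_bigr => i _.
by rewrite pairingZl linearZ /= actZl (nth_mktuple _ 0) pE.
Qed.

(** β is left A-linear and (a ⊗ f) 1_A = a ((1 ⊗ f) 1_A), so only the generators with a = 1 need
    preimages. *)
Lemma beta_surjP : set_surj [set: AtensA act] (AD1 act) (@beta k H A act) <->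
  forall f, exists x : AtensA act, beta x = AD_rmul act (kpure 1 f) 1.
Proof.
split=> [surj f|gen _ [y _ <-]].
  by have [x _ xE] := surj _ (imageT (AD_rmul act ^~ 1) (kpure 1 f)); exists x.
suff [x xE] : exists x : AtensA act, beta x = AD_rmul act y 1 by exists x.
elim/ktens_ind: y => [|a f y [x xE]].
  exists 0; rewrite /AD_rmul (ktlift0 (AD_rmulB2 act 1)).
  exact: (tlift0 (beta_balanced act)).
have [z zE] := gen f; exists (AtensA_lmul a z + x).
rewrite betaD beta_lmul zE xE /AD_rmul (ktliftD (AD_rmulB2 act 1)).
congr (_ + _); apply: eval_dual_inj => h.
rewrite -[X in AD_lmul _ X]/(AD_rmul act _ 1).
rewrite -[X in _ = eval_dual h X]/(AD_rmul act _ 1).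
by rewrite eval_dual_lmul !eval_dual_rmul1 mul1r.
Qed.

Lemma bracket_surjP :
  set_surj [set: AtensA act] (smash_set act) (@bracket k H A act t) <->
  forall h, exists x : AtensA act, bracket t x = smash act 1 h.
Proof.
split=> [surj h|gen _ [y _ <-]].
  have [x _ xE] := surj _ (imageT (AH_mul act ^~ (kpure 1 1)) (kpure 1 h)).
  by exists x; rewrite smashE.
suff [x xE] : exists x : AtensA act, bracket t x = AH_mul act y (kpure 1 1).
  by exists x.
elim/ktens_ind: y => [|a h y [x xE]].
  exists 0; rewrite /AH_mul (ktlift0 (AH_mulB3 act (kpure 1 1))).
  exact: (tlift0 (bracket_balanced act t)).
have [z zE] := gen h; exists (AtensA_lmul a z + x).
rewrite /bracket (tliftD (bracket_balanced act t)) /AH_mul.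
rewrite (ktliftD (AH_mulB3 act (kpure 1 1))); congr (_ + _) => //.
(* Left A-linearity of the bracket is read off from its values in A. *)
apply: eval_hopf_inj => g.
rewrite -[LHS]/(eval_hopf g (bracket t (AtensA_lmul a z))).
rewrite -[RHS]/(eval_hopf g (AH_mul act (kpure a h) (kpure 1 1))) -smashE.
rewrite eval_hopf_bracket pairing_lmul -eval_hopf_bracket zE.
by rewrite !eval_hopf_smash mul1r.
Qed.

End Equivalence.

Theorem theorem3 (k : fieldType) (H : hopfAlgType k) (A : algType k)
    (act : partial_action H A) (act_sym : symmetric_paction act)
    (act1_central : forall (h : H) (a : A), act h 1 * a = a * act h 1)
    (t : H) (t_integral : left_integral t) (t_neq0 : t <> 0) :
  [<-> set_surj [set: AtensA act] (AD1 act) (@beta k H A act);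
       fgp_right act /\ partial_Hopf_Galois act;
       fgp_right act /\
         set_surj [set: AtensA act] (smash_set act) (@bracket k H A act t)].
Proof.
tfae=> [surj|[fgp [_ _ _ [_ _ surj]]]|[_ surj]].
(* Slicing to 1 is what makes the preimage of (1 ⊗ f) 1_A yield a dual basis. *)
- have [f ft] := lslice_integral_surj t_integral t_neq0 1.
  have [x fx] := (beta_surjP act).1 surj f.
  split; first exact: (fgp_right_of_dual_basis act1_central t_integral ft fx).
  split; [exact: betaD|exact: beta_lmul|exact: beta_rmul|].
  split=> //; first exact: beta_AD1.
  by move=> y z _ _; exact: (beta_inj act1_central t_integral ft fx).
- split=> //; apply/bracket_surjP => h.
  (* Writing [h] as a slice turns the target 1 # h into one covered by [beta_bracket]. *)
  have [f <-] := lslice_integral_surj t_integral t_neq0 h.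
  have [x xE] := (beta_surjP act).1 surj f.
  by exists x; apply/beta_bracket.
- apply/beta_surjP => f.
  have [x xE] := (bracket_surjP act t).1 surj (lslice f t).
  by exists x; apply/beta_bracket.
Qed.
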